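(* Let $t\ge1$ and let $\Phi$ be the $(8t+4)\times(8t+4)$ incidence matrix of a $\mathrm{PBIBD}(4)$ with parameters $v=b=8t+4$, $r=k=4t+2$, $\lambda_1=0$, $\lambda_2=2t+1$, $\lambda_3=2t+2$, $\lambda_4=2t$, with respect to the association scheme $A_0,\dots,A_4$ (classes $R_0,\dots,R_4$) defined below from some $(\pm1)$-matrix $M$. Let $E$ be a group with a central subgroup $\langle-1\rangle$ of order $2$, acting as a regular group of automorphisms of the design (regularly on points and regularly on blocks, preserving incidence), such that the design is $R_1$-class regular with respect to $\langle-1\rangle$ (i.e. $\langle-1\rangle$ acts regularly on each point class $\{i,i+4t+2\}$, $1\le i\le 4t+2$). Then there exists a relative $(4t+2,2,4t+2,2t+1)$-quasi-difference set in $E$ with forbidden subgroup $\langle-1\rangle$.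
   Context: $I,J$ denote identity and all-ones matrices, $\otimes$ the Kronecker product, $\mathrm{abs}$ entrywise absolute value. $M$ is a $(4t+2)\times(4t+2)$ $(\pm1)$-matrix with $\mathrm{abs}(MM^\top)=\begin{bmatrix}4tI_{2t+1}+2J_{2t+1}&0\\0&4tI_{2t+1}+2J_{2t+1}\end{bmatrix}$. With $K=I_2\otimes J_{2t+1}$, $\Delta_1=\tfrac14(MM^\top+2K-(4t+4)I)$, $\Delta_2=\tfrac14(2K+4tI-MM^\top)$: $A_0=I_{8t+4}$, $A_1=(J_2-I_2)\otimes I_{4t+2}$, $A_2=J_2\otimes(J_2-I_2)\otimes J_{2t+1}$, $A_3=I_2\otimes\Delta_1+(J_2-I_2)\otimes\Delta_2$, $A_4=I_2\otimes\Delta_2+(J_2-I_2)\otimes\Delta_1$, indexed by the point set $X=\{1,\dots,8t+4\}$, with $R_i=\{(x,y):(A_i)_{xy}=1\}$. A $\mathrm{PBIBD}(4)$ with parameters $v,b,r,k,\lambda_1,\dots,\lambda_4$ on this scheme: $b$ blocks of size $k$, each point in $r$ blocks, points $x,y$ with $(x,y)\in R_i$ ($i\ge1$) together in exactly $\lambda_i$ blocks; $\Phi$ has rows indexed by points and columns by blocks. For a group $E$ of order $8t+4$ and normal subgroup $Z$ of order $2$, a relative $(4t+2,2,4t+2,2t+1)$-quasi-difference set in $E$ with forbidden subgroup $Z$ is a transversal $R$ for $Z$ in $E$ containing a subset $S\subset R\setminus\{1\}$, $|S|=2t+1$, such that for all $x\in E\setminus Z$: $|R\cap xR|=2t+1$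 if $x\in sZ$ for some $s\in S$, and $|R\cap xR|\in\{2t,2t+2\}$ otherwise. *)

(* Defs.v *)
From mathcomp Require Export all_boot all_order all_algebra all_fingroup.
From mathcomp Require Export center mxtens.

Set Implicit Arguments.
Unset Strict Implicit.
Unset Printing Implicit Defensive.

Import Order.TTheory GRing.Theory Num.Theory.
Local Open Scope ring_scope.

(* The sizes 2t+1, 4t+2 and 8t+4 are kept as nested products, the shape that
   the Kronecker product [*t] produces. *)
Definition sz1 (t : nat) : nat := (2 * t + 1)%N.
Definition sz2 (t : nat) : nat := (2 * sz1 t)%N.
Definition sz4 (t : nat) : nat := (2 * sz2 t)%N.

Lemma sz2E t : sz2 t = (4 * t + 2)%N.
Proof. by rewrite /sz2 /sz1 mulnDr mulnA. Qed.

Lemma sz4E t : sz4 t = (8 * t + 4)%N.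
Proof. by rewrite /sz4 sz2E mulnDr mulnA. Qed.

Lemma sz1_add_sz1 t : (sz1 t + sz1 t)%N = sz2 t.
Proof. by rewrite /sz2 mul2n addnn. Qed.

Definition Jmx (n : nat) : 'M[rat]_n := const_mx 1.

Definition abs_mx m n (A : 'M[rat]_(m, n)) : 'M[rat]_(m, n) :=
  map_mx (fun a => `|a|) A.

Definition is_sign_mx m n (A : 'M[rat]_(m, n)) : Prop :=
  forall i j, A i j = 1 \/ A i j = -1.

Definition ew_block (t : nat) : 'M[rat]_(sz1 t) :=
  (4 * t)%:R%:M + 2 *: Jmx (sz1 t).

Definition ew_gram (t : nat) : 'M[rat]_(sz2 t) :=
  castmx (sz1_add_sz1 t, sz1_add_sz1 t)
    (block_mx (ew_block t) 0 0 (ew_block t)).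

Section Scheme.

Variables (t : nat) (M : 'M[rat]_(sz2 t)).

Definition Kmx : 'M[rat]_(sz2 t) := (1%:M : 'M_2) *t Jmx (sz1 t).

Definition Delta1 : 'M[rat]_(sz2 t) :=
  4^-1 *: (M *m M^T + 2 *: Kmx - (4 * t + 4)%:R%:M).

Definition Delta2 : 'M[rat]_(sz2 t) :=
  4^-1 *: (2 *: Kmx + (4 * t)%:R%:M - M *m M^T).

Definition scheme_A0 : 'M[rat]_(sz4 t) := 1%:M.

Definition scheme_A1 : 'M[rat]_(sz4 t) :=
  (Jmx 2 - 1%:M) *t (1%:M : 'M_(sz2 t)).

Definition scheme_A2 : 'M[rat]_(sz4 t) :=
  Jmx 2 *t ((Jmx 2 - 1%:M) *t Jmx (sz1 t)).

Definition scheme_A3 : 'M[rat]_(sz4 t) :=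
  (1%:M : 'M_2) *t Delta1 + (Jmx 2 - 1%:M) *t Delta2.

Definition scheme_A4 : 'M[rat]_(sz4 t) :=
  (1%:M : 'M_2) *t Delta2 + (Jmx 2 - 1%:M) *t Delta1.

Definition scheme : 5.-tuple 'M[rat]_(sz4 t) :=
  [tuple scheme_A0; scheme_A1; scheme_A2; scheme_A3; scheme_A4].

End Scheme.

Definition scheme_rel m v (A : m.+1.-tuple 'M[rat]_v) (i : 'I_m.+1)
  : rel 'I_v := fun x y => tnth A i x y == 1.

(* [Phi] is the points-by-blocks incidence matrix of a PBIBD(m) with [v] points
   and [b] blocks on the classes given by [A].  The m-tuple [lambda] is indexed
   from 0, so that its entry [i] belongs to the class [i + 1]. *)
Record is_PBIBD m v b (A : m.+1.-tuple 'M[rat]_v) (Phi : 'M[rat]_(v, b))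
    (r k : nat) (lambda : m.-tuple nat) : Prop := IsPBIBD {
  pbibd_01 : forall x B, Phi x B = 0 \/ Phi x B = 1;
  pbibd_block_size : forall B, #|[set x | Phi x B == 1]| = k;
  pbibd_replication : forall x, #|[set B | Phi x B == 1]| = r;
  pbibd_concurrence : forall (i : 'I_m) x y,
    scheme_rel A (lift ord0 i) x y ->
    #|[set B | (Phi x B == 1) && (Phi y B == 1)]| = tnth lambda i
}.

(* The points are numbered from 0, so [i] ranges over 0, ..., 4t+1. *)
Definition point_class (t : nat) (i : 'I_(sz2 t)) : {set 'I_(sz4 t)} :=
  [set x : 'I_(sz4 t) | (x == i :> nat) || (x == i + sz2 t :> nat)%N].

Section GroupNotions.

Local Open Scope group_scope.

Definition regular_on (gT : finGroupType) (D : {set gT}) (T : finType)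
    (to : action D T) (H : {set gT}) (S : {set T}) : Prop :=
  [transitive H, on S | to] /\ {in S, forall x, 'C_H[x | to] = 1}.

(* MathComp actions are right actions; composing with the inverse of [E]
   exchanges them with left actions and preserves every condition imposed. *)
Record regular_automorphisms v b (Phi : 'M[rat]_(v, b))
    (gT : finGroupType) (E : {group gT})
    (toP : action E 'I_v) (toB : action E 'I_b) : Prop :=
  RegularAutomorphisms {
  regular_points : regular_on toP E [set: 'I_v];
  regular_blocks : regular_on toB E [set: 'I_b];
  incidence_preserved :
    forall g x B, g \in E -> Phi (toP x g) (toB B g) = Phi x B
}.

Record is_quasi_diffset (t : nat) (gT : finGroupType) (E Z : {group gT})
    (R : {set gT}) : Prop := IsQuasiDiffset {
  qds_order : #|E| = (8 * t + 4)%N;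
  qds_normal : Z <| E;
  qds_forbidden : #|Z| = 2%N;
  qds_transversal : is_transversal R (lcosets Z E) E;
  qds_cond : exists S : {set gT},
    [/\ S \subset R :\ 1,
        #|S| = (2 * t + 1)%N
      & forall x, x \in E :\: Z ->
        if [exists s in S, x \in s *: Z]
        then #|R :&: (x *: R)| = (2 * t + 1)%N
        else #|R :&: (x *: R)| = (2 * t)%N
             \/ #|R :&: (x *: R)| = (2 * t + 2)%N]
}.

End GroupNotions.

(* Main.v *)
(* Fix a point x0 and a block B0, and let R be the set of g in E that carry x0
   into B0.  Regularity on blocks turns |R :&: xR| into the number of blocks
   through x0 and x0 x^-1, which is lambda_2, lambda_3 or lambda_4 for x outside
   <z>.  Since lambda_1 = 0, R meets each coset of <z> at most once, and
   |E| = 2|R| makes it a transversal.  The x with x0 x^-1 in relation R_2 to x0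
   form a union D of 2t+1 cosets of <z>, so S = R :&: D does the job; it avoids
   1 because x0 is not R_2-related to itself. *)
Require Import Defs.
From mathcomp Require Import zify lra.

Set Implicit Arguments.
Unset Strict Implicit.
Unset Printing Implicit Defensive.

Import Order.TTheory GRing.Theory Num.Theory.
Local Open Scope ring_scope.

(** * Entries of the association scheme *)

(* [class_of x] and [half_of m] are the Kronecker coordinates of a point: the
   class of [x] under A_1, and the diagonal block of [M M^T] containing [m]. *)
Definition class_of t (x : 'I_(sz4 t)) : 'I_(sz2 t) :=
  (@mxtens_unindex 2 (sz2 t) x).2.

Definition half_of t (m : 'I_(sz2 t)) : 'I_2 :=
  (@mxtens_unindex 2 (sz1 t) m).1.

Lemma class_of_index t a (m : 'I_(sz2 t)) : class_of (mxtens_index (a, m)) = m.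
Proof. by rewrite /class_of mxtens_indexK. Qed.

Lemma half_of_index t c (p : 'I_(sz1 t)) : half_of (mxtens_index (c, p)) = c.
Proof. by rewrite /half_of mxtens_indexK. Qed.

Lemma in_point_class t (m : 'I_(sz2 t)) x :
  (x \in point_class m) = (class_of x == m).
Proof.
case: (@mxtens_indexP 2 (sz2 t) x) => a m'.
rewrite inE class_of_index -val_eqE /=.
by case: a => -[|[|//]] /= _; have := ltn_ord m; have := ltn_ord m'; lia.
Qed.

Lemma Jsub1E (i j : 'I_2) : (Jmx 2 - 1%:M) i j = (i != j)%:R.
Proof. by rewrite !mxE; case: eqP => _; rewrite ?subrr ?subr0. Qed.

Lemma scheme_A1E t (x y : 'I_(sz4 t)) :
  x != y -> class_of x = class_of y -> scheme_A1 t x y = 1.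
Proof.
rewrite /scheme_A1.
case: (@mxtens_indexP 2 (sz2 t) x) => a m.
case: (@mxtens_indexP 2 (sz2 t) y) => b m'.
rewrite !class_of_index => neq eqm; rewrite -{}eqm in neq *.
rewrite tensmxE Jsub1E mxE eqxx mulr1.
by case: (eqVneq a b) neq => // ->; rewrite eqxx.
Qed.

Lemma scheme_A2E t (x y : 'I_(sz4 t)) :
  half_of (class_of x) != half_of (class_of y) -> scheme_A2 t x y = 1.
Proof.
rewrite /scheme_A2.
case: (@mxtens_indexP 2 (sz2 t) x) => a m.
case: (@mxtens_indexP 2 (sz2 t) y) => b m'.
rewrite !class_of_index.
case: (@mxtens_indexP 2 (sz1 t) m) => c p.
case: (@mxtens_indexP 2 (sz1 t) m') => d q.
by rewrite !half_of_index => ncd; rewrite 2!tensmxE Jsub1E ncd !mxE !mulr1.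
Qed.

Lemma ew_gram_same_half t (m m' : 'I_(sz2 t)) :
  m != m' -> half_of m = half_of m' -> ew_gram t m m' = 2.
Proof.
case: (@mxtens_indexP 2 (sz1 t) m) => c p.
case: (@mxtens_indexP 2 (sz1 t) m') => d q.
rewrite !half_of_index => neq eqcd; rewrite -{}eqcd in neq *.
have npq : p != q by case: (eqVneq p q) neq => // ->; rewrite eqxx.
have eb : ew_block t p q = 2.
  by rewrite !mxE (negPf npq) mulr0n add0r mulr1.
rewrite /ew_gram castmxE.
(* The value of [c] selects the diagonal block: 1 the lower right, 0 the upper left; [c > 1] is
   impossible in ['I_2]. *)
case: (ltngtP c 1%N) => [c0 | /= | c1]; last 1 first.
- have shiftE r : cast_ord (esym (sz1_add_sz1 t)) (mxtens_index (c, r))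
      = rshift (sz1 t) r.
    by apply: val_inj; rewrite /= c1 mul1n.
  by rewrite !shiftE block_mxEdr.
- have shiftE r : cast_ord (esym (sz1_add_sz1 t)) (mxtens_index (c, r))
      = lshift (sz1 t) r.
    by apply: val_inj; move: c0; rewrite ltnS leqn0 /= => /eqP->; rewrite mul0n.
  by rewrite !shiftE block_mxEul.
by rewrite ltnNge -ltnS ltn_ord.
Qed.

(** Off the diagonal of a half, the entry [g] of [M *m M^T] is 2 or -2, so [Delta1] and [Delta2]
    have entries [(g + 2) / 4] and [(2 - g) / 4]: one is 1, the other 0. *)
Lemma scheme_A34E t (M : 'M[rat]_(sz2 t)) (x y : 'I_(sz4 t)) :
  abs_mx (M *m M^T) = ew_gram t ->
  class_of x != class_of y ->
  half_of (class_of x) = half_of (class_of y) ->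
  scheme_A3 M x y = 1 \/ scheme_A4 M x y = 1.
Proof.
move=> hMM; rewrite /scheme_A3 /scheme_A4.
case: (@mxtens_indexP 2 (sz2 t) x) => a m.
case: (@mxtens_indexP 2 (sz2 t) y) => b m'.
rewrite !class_of_index => nm eqh.
rewrite /Delta1 /Delta2; move: (M *m M^T) hMM => G hMM.
have absG : `|G m m'| = 2.
  by have := ew_gram_same_half nm eqh; rewrite -hMM [LHS]mxE.
have K1 : Kmx t m m' = 1.
  move: eqh; rewrite /Kmx.
  case: (@mxtens_indexP 2 (sz1 t) m) => c p.
  case: (@mxtens_indexP 2 (sz1 t) m') => d q.
  by rewrite !half_of_index => <-; rewrite tensmxE !mxE eqxx mulr1.
move: (Kmx t) K1 => K K1.
have entry (U V : 'M[rat]_(sz2 t)) : ((1%:M : 'M_2) *t U + (Jmx 2 - 1%:M) *t V)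
    (mxtens_index (a, m)) (mxtens_index (b, m')) =
    if a == b then U m m' else V m m'.
  rewrite mxE 2!tensmxE Jsub1E mxE.
  by case: eqP; rewrite /= mul1r mul0r ?addr0 ?add0r.
rewrite !{}entry !mxE K1 (negPf nm) !mulr0n.
by case: (a == b); case: (ger0P (G m m')) absG => _ absG;
  [left | right | right | left]; lra.
Qed.

(** Two choices of the outer coordinate, one other half, [sz1 t] positions in it. This count later
    gives the size of [D]. *)
Lemma card_other_half t (x : 'I_(sz4 t)) :
  #|[set y | half_of (class_of x) != half_of (@class_of t y)]|
  = (2 * (2 * t + 1))%N.
Proof.
set h := half_of _.
pose f (p : 'I_2 * ('I_2 * 'I_(sz1 t))) : 'I_(sz4 t) :=
  mxtens_index (p.1, mxtens_index p.2).
have finj : injective f.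
  move=> [a p] [b q] /(can_inj (@mxtens_indexK _ _)) e.
  have /= -> := congr1 fst e.
  by have /(can_inj (@mxtens_indexK _ _)) /= -> := congr1 snd e.
suff -> : [set y | h != half_of (class_of y)]
          = f @: setX setT (setX [set~ h] setT).
  by rewrite card_imset // !cardsX !cardsT cardsC1 !card_ord mul1n.
apply/setP => y; rewrite inE.
case: (@mxtens_indexP 2 (sz2 t) y) => a m.
case: (@mxtens_indexP 2 (sz1 t) m) => c p.
rewrite class_of_index half_of_index.
by rewrite (mem_imset _ (a, (c, p)) finj) !inE /= andbT eq_sym.
Qed.

(** * Regular actions *)

Section RegularActions.

Local Open Scope group_scope.

Variables (aT : finGroupType) (E : {group aT}) (rT : finType).
Variable to : action E rT.

Lemma regular_on_inj (H : {group aT}) (S : {set rT}) x :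
  H \subset E -> regular_on to H S -> x \in S -> {in H &, injective (to x)}.
Proof.
move=> sHE [_ reg] Sx g h Hg Hh eq_gh; apply/eqP; rewrite eq_mulgV1.
have Eg := subsetP sHE g Hg; have Eh := subsetP sHE h Hh.
suff: g * h^-1 \in 'C_H[x | to] by rewrite reg // => /set1P->.
rewrite !inE groupM ?groupV ?Eg ?Eh //=.
by rewrite sub1set !inE actMin ?groupM ?groupV // eq_gh actKin /=.
Qed.

(** Regularity makes [to x] a bijection from [E] onto the set acted on, so counts of points or
    blocks become counts of group elements. *)
Lemma card_regular_preim (P : pred rT) x :
  regular_on to E setT -> #|[set g in E | P (to x g)]| = #|[set y | P y]|.
Proof.
move=> reg.
have -> : [set y | P y] = to x @: [set g in E | P (to x g)].
  apply/setP => y; rewrite inE; apply/idP/imsetP => [Py | [g]].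
    have /imsetP[g Eg def_y] : y \in orbit to E x.
      by rewrite (atransPin (subxx E) reg.1) ?inE.
    by exists g; rewrite // inE Eg -def_y.
  by rewrite inE => /andP[_ Pg] ->.
rewrite card_in_imset // => g h; rewrite !inE => /andP[Eg _] /andP[Eh _].
exact: (regular_on_inj _ reg).
Qed.

End RegularActions.

(** * Cosets of a central involution *)

Section CentralInvolution.

Local Open Scope group_scope.

Variables (gT : finGroupType) (E : {group gT}) (z : gT).

Lemma mem_lcoset_involution g h :
  #[z] = 2%N -> (h \in g *: <[z]>) = (h == g) || (h == g * z).
Proof.
move=> oz; suff -> : <[z]> = [set 1; z].
  rewrite mem_lcoset in_set2 -eq_mulVg1 eq_sym -[in X in _ || X](mulKg g z).
  by rewrite (inj_eq (mulgI _)).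
apply/eqP; rewrite eq_sym eqEcard subUset !sub1set group1 cycle_id cards2.
by rewrite -[#|<[z]>|]/#[z] oz; case: eqP oz => // <-; rewrite order1.
Qed.

Lemma central_cycle_norm : z \in 'Z(E) -> E \subset 'N(<[z]>).
Proof.
by move=> /setIP[_ cEz]; rewrite cents_norm // cent_cycle sub_cent1.
Qed.

(** The coset of [g] is the pair [g], [g * z], and the last hypothesis puts exactly one of the two
    in [R]. *)
Lemma is_transversal_central_involution (R : {set gT}) :
    z \in 'Z(E) -> #[z] = 2%N -> R \subset E ->
    {in E, forall g, (g * z \in R) = (g \notin R)} ->
  is_transversal R (lcosets <[z]> E) E.
Proof.
move=> Zz oz sRE Rz; rewrite /is_transversal sRE /=; apply/andP; split.
  have -> : lcosets <[z]> E = rcosets <[z]> E.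
    apply: eq_in_imset => g Eg; rewrite lcosetE rcosetE norm_rlcoset //.
    by rewrite (subsetP (central_cycle_norm Zz)).
  by rewrite rcosets_partition // cycle_subG; case/setIP: Zz.
apply/forall_inP => _ /lcosetsP[g Eg ->]; apply/cards1P.
exists (if g \in R then g else g * z); apply/setP => h.
rewrite in_setI mem_lcoset_involution // in_set1.
case Rg: (g \in R); case: eqP => [->|_] /=; rewrite ?andbT ?Rg //.
- by case: eqP => [->|_]; rewrite ?andbF // Rz // Rg.
- by apply/esym/eqP => gz; have := Rz g Eg; rewrite -gz Rg.
- by case: eqP => [->|_]; rewrite ?andbF // Rz // Rg.
Qed.

(** Right multiplication by [z] exchanges the parts of [D] inside and outside [R]. *)
Lemma card_setI_involution (R D : {set gT}) :
    z * z = 1 -> {in E, forall g, (g * z \in R) = (g \notin R)} ->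
    D \subset E -> {in D, forall g, g * z \in D} ->
  #|D| = (2 * #|R :&: D|)%N.
Proof.
move=> zz Rz sDE Dz.
have zV : z^-1 = z by apply/eqP; rewrite eq_invg_mul zz.
rewrite mul2n -addnn -{1}(cardsID R D) setIC; congr addn.
rewrite -(card_rcoset (R :&: D) z); apply: eq_card => g.
rewrite mem_rcoset zV in_setD in_setI.
apply/andP/andP => [[nRg Dg] | [Rgz Dgz]].
  by rewrite Rz ?(subsetP sDE) // Dz.
have Dg : g \in D by rewrite -[g]mulg1 -zz mulgA Dz.
by split=> //; rewrite -Rz ?(subsetP sDE).
Qed.

End CentralInvolution.

(** * Construction of the quasi-difference set *)

Theorem theorem6 (t : nat) (ht : (1 <= t)%N)
  (M : 'M[rat]_(sz2 t))
  (hM : is_sign_mx M)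
  (hMM : abs_mx (M *m M^T) = ew_gram t)
  (Phi : 'M[rat]_(sz4 t))
  (hPhi : is_PBIBD (scheme M) Phi (4 * t + 2) (4 * t + 2)
            [tuple 0%N; (2 * t + 1)%N; (2 * t + 2)%N; (2 * t)%N])
  (gT : finGroupType) (E : {group gT})
  (toP : action E 'I_(sz4 t)) (toB : action E 'I_(sz4 t))
  (hE : regular_automorphisms Phi toP toB)
  (z : gT) (hz : z \in ('Z(E))%g) (oz : #[z]%g = 2%N)
  (hclass : forall i : 'I_(sz2 t), regular_on toP <[z]>%g (point_class i)) :
  exists R : {set gT}, is_quasi_diffset t E <[z]>%G R.
Proof.
have [regP regB incid] := hE.
have [_ block_size _ conc] := hPhi.
pose cc x y := #|[set B | (Phi x B == 1) && (Phi y B == 1)]|.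
(* Indices of [conc] start at 0: [conc 0] concerns the class R_1, and so on up to [conc 3%:R] for
   R_4. *)
have cc1 x y : x != y -> class_of x = class_of y -> cc x y = 0%N.
  by move=> nxy exy; apply: (conc 0); apply/eqP/scheme_A1E.
have cc2 x y : half_of (class_of x) != half_of (class_of y) ->
    cc x y = (2 * t + 1)%N.
  by move=> h; apply: (conc 1); apply/eqP/scheme_A2E.
have cc34 x y : class_of x != class_of y ->
    half_of (class_of x) = half_of (class_of y) ->
    cc x y = (2 * t)%N \/ cc x y = (2 * t + 2)%N.
  move=> nxy exy; have [A1|A1] := scheme_A34E hMM nxy exy.
    by right; apply: (conc 2%:R); apply/eqP.
  by left; apply: (conc 3%:R); apply/eqP.
have /centerP[Ez cEz] := hz.
set Z := <[z]>%G.
have sZE : Z \subset E by rewrite cycle_subG.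
have n0 : (0 < sz4 t)%N by rewrite sz4E addnS.
pose x0 := Ordinal n0; pose B0 := x0.
have Zclass x : toP x z != x /\ class_of (toP x z) = class_of x.
  have Sx : x \in point_class (class_of x) by rewrite in_point_class.
  split; last first.
    apply/eqP; rewrite -in_point_class -(atransPin sZE (hclass _).1 Sx).
    by apply/imsetP; exists z; rewrite ?cycle_id.
  apply/eqP; rewrite -{2}[x](act1 toP).
  move/(regular_on_inj sZE (hclass _) Sx (cycle_id z) (group1 _)) => z1.
  by move: oz; rewrite z1 order1.
(* Some [c] in [Z] moves [x] as [g] does, by transitivity on the class; regularity of [E] on points
   then forces [g = c]. *)
have Zorbit x g : g \in E -> class_of (toP x g) = class_of x -> g \in Z.
  move=> Eg; have Sx : x \in point_class (class_of x) by rewrite in_point_class.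
  move/eqP; rewrite -in_point_class -(atransPin sZE (hclass _).1 Sx).
  case/imsetP=> c Zc /(regular_on_inj (subxx E) regP (in_setT x) Eg).
  by move=> -> //; apply: (subsetP sZE).
have zz : (z * z = 1)%g by rewrite -[(z * z)%g]/(z ^+ 2)%g -oz expg_order.
have zV : (z^-1 = z)%g by apply/eqP; rewrite eq_invg_mul zz.
pose R := [set g in E | Phi (toP x0 g) B0 == 1].
have sRE : R \subset E by apply/subsetP => g; rewrite inE => /andP[].
have cardR : #|R| = (4 * t + 2)%N.
  rewrite -(block_size B0).
  by rewrite -(card_regular_preim (fun y => Phi y B0 == 1) x0 regP).
have cardE : #|E| = (8 * t + 4)%N.
  rewrite -sz4E -[RHS]card_ord -cardsT -(card_regular_preim predT x0 regP).
  by apply: eq_card => g; rewrite inE andbT.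
have RzF g : g \in R -> (g * z)%g \notin R.
  rewrite !inE => /andP[Eg Rg]; apply/negP => /andP[_ Rgz].
  have [neq eqc] := Zclass (toP x0 g).
  have /eqP := cc1 _ _ neq eqc; rewrite cards_eq0 => /eqP/setP/(_ B0).
  by rewrite !inE Rg -actMin // Rgz.
have Rz g : g \in E -> ((g * z)%g \in R) = (g \notin R).
  move=> Eg; apply/idP/idP => [/RzF|]; first by rewrite -mulgA zz mulg1.
  (* The translate of [R] by [z] lies in [E :\: R], and both have 4t+2 elements. *)
  move=> nRg; suff ED : (R :* z)%g = E :\: R.
    by rewrite -[z]zV -mem_rcoset ED in_setD nRg.
  apply/eqP; rewrite eqEcard card_rcoset cardsDS // cardR cardE.
  apply/andP; split; last by lia.
  apply/subsetP => h; rewrite mem_rcoset zV => Rhz.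
  by rewrite in_setD -(groupMr h Ez) (subsetP sRE) // -[h]mulg1 -zz mulgA RzF.
(* The inverse matches [RxR] below, where [x] is governed by the pair [x0], [toP x0 x^-1]. *)
pose D := [set g in E | half_of (class_of x0) !=
                        half_of (class_of (toP x0 g^-1)%g)].
have Dz : {in D, forall g, (g * z)%g \in D}.
  move=> g; rewrite !inE => /andP[Eg Dg]; rewrite groupM //=.
  by rewrite invMg zV (cEz _ (groupVr Eg)) actMin ?groupV // (Zclass _).2.
have sDE : D \subset E by apply/subsetP => g; rewrite inE => /andP[].
have cardRD : #|R :&: D| = (2 * t + 1)%N.
  apply/eqP; rewrite -(eqn_pmul2l (isT : 0 < 2)%N).
  rewrite -(card_setI_involution zz Rz) //.
  rewrite -(card_other_half x0) -(card_regular_preim _ x0 regP) -card_invg.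
  by apply/eqP; apply: eq_card => g; rewrite !inE groupV.
have shift x h : h \in E -> Phi (toP x h^-1)%g B0 = Phi x (toB B0 h).
  by move=> Eh; rewrite -(incid h) // -actMin ?groupV // mulVg act1.
(* Write a block as [toB B0 h]. By [shift] it contains [x0] iff [h^-1] is in [R], and [toP x0 x^-1]
   iff [x^-1 * h^-1] is in [R], that is, [h^-1] is in [x *: R]. *)
have RxR x : x \in E -> #|R :&: (x *: R)%g| = cc x0 (toP x0 x^-1)%g.
  move=> Ex; rewrite /cc -(card_regular_preim _ B0 regB) -card_invg.
  apply: eq_card => h; rewrite !inE mem_lcoset !inE groupV.
  case Eh: (h^-1 \in E)%g; rewrite groupV in Eh; rewrite ?Eh //=.
  rewrite groupMl ?groupV // Eh /= actMin ?groupV //.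
  by rewrite !shift.
exists R; split=> //.
- by rewrite /normal sZE central_cycle_norm.
- exact: is_transversal_central_involution.
- exists (R :&: D); split=> //.
    apply/subsetP => g; rewrite in_setI in_setD1 => /andP[Rg].
    rewrite Rg inE andbT => /andP[_].
    by apply: contraNneq => ->; rewrite invg1 act1.
  move=> x /setDP[Ex nZx].
  (* Outside [Z] the two points lie in different classes, so only [cc2] and [cc34] can apply. *)
  have nc : class_of x0 != class_of (toP x0 x^-1)%g.
    by apply: contraNneq nZx => /esym /Zorbit; rewrite !groupV; apply.
  rewrite RxR //.
  (* [D] is a union of cosets of [Z], and [R] contains [x] or [x * z], which serves as [s]. *)
  have -> : [exists s in R :&: D, x \in (s *: Z)%g] = (x \in D).
    apply/exists_inP/idP => [[s /setIP[_ Ds]] | Dx].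
      by rewrite mem_lcoset_involution // => /orP[] /eqP-> //; apply: Dz.
    case Rx: (x \in R).
      by exists x; rewrite ?in_setI ?Rx // mem_lcoset_involution // eqxx.
    exists (x * z)%g; first by rewrite in_setI Rz // Rx Dz.
    by rewrite mem_lcoset_involution // -mulgA zz mulg1 eqxx orbT.
  rewrite inE Ex /=; case: ifPn => [|/negPn/eqP]; first exact: cc2.
  exact: cc34.
Qed.
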